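(* Let $\mathbb{F}_q$ be a finite field with $q$ elements. There exists a sequence $\omega$ of polynomials in $\mathbb{F}_q[T]$ such that $\deg h \ll r_h(\omega) \ll \deg h$ for all $h \in \mathbb{F}_q[T]$ with $\deg h$ sufficiently large; that is, there are constants $C_1, C_2 > 0$ and $n_0$ such that $C_1 \deg h \le r_h(\omega) \le C_2 \deg h$ for every $h\in\mathbb{F}_q[T]$ with $\deg h \ge n_0$.
   Context: For a sequence $\omega$ of polynomials in $\mathbb{F}_q[T]$ we write $f\in\omega$ if $f$ occurs in $\omega$. For $h \in \mathbb{F}_q[T]$ define $r_h(\omega) = |\{(f,g)\in \mathbb{F}_q[T]\times\mathbb{F}_q[T] : f,g\in\omega,\ f+g=h,\ \deg f,\deg g\le \deg h,\ f\neq g\}|$ (ordered pairs). The convention $\deg 0 = -\infty$ is used. *)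

(* Defs.v *)
From mathcomp Require Import all_boot all_order all_algebra finmap.
From mathcomp Require Import boolp classical_sets functions cardinality.

Set Implicit Arguments.
Unset Strict Implicit.
Unset Printing Implicit Defensive.

Import Order.TTheory GRing.Theory Num.Theory.
Local Open Scope classical_set_scope.
Local Open Scope ring_scope.

(* [size p] is [deg p + 1] for [p != 0] and [size 0 = 0], so with the
   convention [deg 0 = -oo], [deg f <= deg h] is [size f <= size h] and, for
   [n : nat], [n <= deg h] is [n < size h] (the latter excludes [h = 0]). *)

Definition rep_pairs (F : finFieldType) (omega : nat -> {poly F})
    (h : {poly F}) : set ({poly F} * {poly F}) :=
  [set fg | [/\ range omega fg.1, range omega fg.2, fg.1 + fg.2 = h,
                (size fg.1 <= size h)%N /\ (size fg.2 <= size h)%N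
              & fg.1 != fg.2]].

(* [fset_set A] is the empty set when [A] is infinite; this never happens
   here, by [finite_rep_pairs]. *)
Definition rep_count (F : finFieldType) (omega : nat -> {poly F})
    (h : {poly F}) : nat := #|` fset_set (rep_pairs omega h)|.

Lemma finite_size_le (F : finFieldType) (n : nat) :
  finite_set [set p : {poly F} | (size p <= n)%N].
Proof.
apply: (@sub_finite_set _ _ (range (fun p : {poly_n F} => p : {poly F}))).
  by move=> p /= hp; exists (NPoly hp).
exact/finite_image/finite_finset.
Qed.

Lemma finite_rep_pairs (F : finFieldType) (omega : nat -> {poly F})
    (h : {poly F}) : finite_set (rep_pairs omega h).
Proof.
have fin := finite_size_le F (size h).
apply: sub_finite_set (finite_setX fin fin).
by move=> [f g] [_ _ _ [? ?] _].
Qed.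

(* Main.v *)
Require Import Defs.
From mathcomp Require Import finmap boolp classical_sets cardinality.
From mathcomp Require Import all_boot all_order all_algebra.
From mathcomp Require Import reals sequences exp.
From mathcomp Require Import zify ring lra.

Import Order.TTheory GRing.Theory Num.Theory.
Local Open Scope ring_scope.

(* The members of the sequence of degree [n] are chosen degree by degree.
   Write a polynomial of degree [n] as [u * 'X^e + w] with [size w <= e], where
   [#|F| ^ (n - 2e)] is of order [n]; the members of degree [n] are those on
   the graph [w = phi u] of a random function [phi].  If [h] has degree [n], its
   representations pair a member of degree [n] either with one of lower degree,
   already fixed, or with another one of degree [n].  The number of the former is
   a sum of independent indicators over [u], the number of the latter at most
   twice such a sum over representatives of the orbits of [u |-> h - u], and the
   expectations are of order [n].  Exponential moments make the probability of a
   deviation for a given [h] smaller than the inverse of the number of [h]. *)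

(** * Exponential moments for a uniformly random function [phi : U -> W] *)

Section RandomGraph.
Set Implicit Arguments.
Unset Strict Implicit.
Variables (R : realType) (U W : finZmodType).
Local Notation M := (#|W|%:R : R).

Lemma card_zmod_gt0 : 0 < M.
Proof. by rewrite ltr0n; apply/card_gt0P; exists 0. Qed.

Lemma card_mulr_sum (T : finType) (c : R) : #|T|%:R * c = \sum_(x : T) c.
Proof. by rewrite mulr_natl sumr_const. Qed.

Lemma prod_indicator (t : R) (P : pred U) :
  \prod_u (if P u then t else 1) = t ^+ #|[set u | P u]|.
Proof.
rewrite -big_mkcond /= prodr_const; congr (_ ^+ _).
by apply: eq_card => u; rewrite inE.
Qed.

(** Values of [phi] at distinct points are independent, so the sum factors over [u]; each factor is
    [M * (1 + (t - 1) * #|E u| / M)], and [1 + x <= expR x]. Taking [t < 1] gives lower tails,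
    [t > 1] upper tails. *)
Lemma mgf_le (t : R) (E : U -> {set W}) : 0 <= t ->
  \sum_(phi : {ffun U -> W}) t ^+ #|[set u | phi u \in E u]| <=
  #|{ffun U -> W}|%:R * expR ((t - 1) * (\sum_u #|E u|)%:R / M).
Proof.
move=> t0.
under [X in X <= _]eq_bigr => phi _ do
  rewrite -(prod_indicator t (fun u => phi u \in E u)).
rewrite -(bigA_distr_bigA (fun u w => if w \in E u then t else 1)).
have -> : expR ((t - 1) * (\sum_u #|E u|)%:R / M) =
  \prod_u expR ((t - 1) * #|E u|%:R / M).
  by rewrite -expR_sum -mulr_suml -mulr_sumr natr_sum.
have -> : #|{ffun U -> W}|%:R = \prod_(u : U) M.
  by rewrite card_ffun natrX prodr_const.
rewrite -big_split /=; apply: ler_prod => u _; apply/andP; split.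
  by apply: sumr_ge0 => w _; case: ifP.
have -> : \sum_w (if w \in E u then t else 1) = M * (1 + (t - 1) * #|E u|%:R / M).
  have -> : \sum_w (if w \in E u then t else 1) = \sum_w (1 + (if w \in E u then t - 1 else 0)).
    by apply: eq_bigr => w _; case: ifP => _; ring.
  rewrite big_split /= -big_mkcond /= !sumr_const -mulr_natr.
  have := card_zmod_gt0 => ?; field; exact: lt0r_neq0.
by rewrite ler_pM2l ?card_zmod_gt0 // expR_ge1Dx.
Qed.

(* Averaging over the shifts of [phi] by functions supported on [P] makes the
   events attached to distinct [x \in P] independent once [phi] is fixed. *)
Lemma mgf_sum_le (t : R) (P : {set U}) (tau : U -> U) (w : W) :
  1 <= t -> (forall x, x \in P -> tau x \notin P) ->
  \sum_(phi : {ffun U -> W}) t ^+ #|[set u in P | phi u + phi (tau u) == w]| <=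
  #|{ffun U -> W}|%:R * expR ((t - 1) * #|U|%:R / M).
Proof.
move=> t1 tauP.
pose G (phi : {ffun U -> W}) := t ^+ #|[set u in P | phi u + phi (tau u) == w]|.
pose mask (chi : {ffun U -> W}) := [ffun u => if u \in P then chi u else 0].
have N0 : 0 < #|{ffun U -> W}|%:R :> R.
  by rewrite ltr0n; apply/card_gt0P; exists 0.
rewrite -(ler_pM2l N0).
have -> : #|{ffun U -> W}|%:R * \sum_phi G phi =
    \sum_(psi : {ffun U -> W}) \sum_(chi : {ffun U -> W}) G (psi + mask chi).
  rewrite exchange_big /= card_mulr_sum; apply: eq_bigr => chi _.
  by rewrite [LHS](reindex_inj (addIr (mask chi))).
rewrite card_mulr_sum; apply: ler_sum => psi _.
(* The mask vanishes at [tau u], so for [u \in P] the event pins [chi u] to one value determined by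
   [psi]. *)
pose E u := if u \in P then [set w - psi (tau u) - psi u] else set0.
have -> : \sum_(chi : {ffun U -> W}) G (psi + mask chi) = \sum_(chi : {ffun U -> W}) t ^+ #|[set u | chi u \in E u]|.
  apply: eq_bigr => chi _; congr (_ ^+ _); apply: eq_card => u.
  rewrite !inE /E; case: ifPn => uP; last by rewrite inE.
  rewrite !inE !ffunE uP (negbTE (tauP _ uP)) addr0 /=.
  rewrite [RHS]eq_sym !subr_eq [RHS]eq_sym; congr (_ == w).
  by rewrite (addrC (chi u)).
apply: le_trans (mgf_le _ _) _; first exact: le_trans t1.
rewrite ler_pM2l // ler_expR ler_pM2r ?invr_gt0 ?card_zmod_gt0 //.
rewrite ler_wpM2l ?subr_ge0 // ler_nat -sum1_card leq_sum // => u _.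
by rewrite /E; case: ifP => _; rewrite ?cards1 ?cards0.
Qed.

(** In the application [B] holds the members of lower degree and [(u, phi u)] is a member of top
    degree. *)
Definition cross_count (B : {set U * W}) (phi : {ffun U -> W}) (h : U * W) :=
  #|[set u | (h.1 - u, h.2 - phi u) \in B]|.

Definition self_count (phi : {ffun U -> W}) (h : U * W) :=
  #|[set u | (u != h.1 - u) && (phi u + phi (h.1 - u) == h.2)]|.

(** This makes the mean of [cross_count] equal to [#|B| / M], whatever [h] is. *)
Lemma sum_slices (B : {set U * W}) (h : U * W) :
  (\sum_u #|[set w | (h.1 - u, h.2 - w)%R \in B]| = #|B|)%N.
Proof.
transitivity (\sum_u \sum_w if (h.1 - u, h.2 - w)%R \in B then 1 else 0)%N.
  apply: eq_bigr => u _; rewrite -sum1_card big_mkcond /=.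
  by apply: eq_bigr => w _; rewrite inE.
rewrite pair_big /= -sum1_card [RHS]big_mkcond /=.
rewrite [RHS](reindex_inj (h := fun p : U * W => (h.1 - p.1, h.2 - p.2))) //=.
by move=> [u w] [u' w'] /= [/addrI/oppr_inj-> /addrI/oppr_inj->].
Qed.

Lemma mgf_cross_le (t : R) (B : {set U * W}) (h : U * W) : 0 <= t ->
  \sum_(phi : {ffun U -> W}) t ^+ cross_count B phi h <=
  #|{ffun U -> W}|%:R * expR ((t - 1) * #|B|%:R / M).
Proof.
move=> t0.
have := mgf_le (fun u => [set w | (h.1 - u, h.2 - w) \in B]) t0.
rewrite sum_slices; apply: le_trans.
rewrite le_eqVlt; apply/orP; left; apply/eqP.
apply: eq_bigr => phi _; congr (_ ^+ _).
by apply: eq_card => u; rewrite !inE.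
Qed.

(** One representative of each two-element orbit of [u |-> h1 - u]; fixed points are left out. The
    involution maps no element of the set into it, as [mgf_sum_le] requires. *)
Definition half (h1 : U) : {set U} :=
  [set u | (enum_rank u < enum_rank (h1 - u)%R)%N].

Definition half_count (phi : {ffun U -> W}) (h : U * W) :=
  #|[set u in half h.1 | phi u + phi (h.1 - u) == h.2]|.

Lemma self_count_le (phi : {ffun U -> W}) (h : U * W) :
  (self_count phi h <= 2 * half_count phi h)%N.
Proof.
case: h => h1 h2; rewrite /self_count /half_count /=.
set H := [set u in _ | _].
rewrite mul2n -addnn -{2}(card_imset H (inv_inj (subKr h1))).
apply: leq_trans (leq_card_setU _ _); apply/subset_leq_card/subsetP => u.
rewrite inE /= => /andP[neq_u sum_u]; apply/setUP.
have [lt_u|le_u] := ltnP (enum_rank u) (enum_rank (h1 - u)).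
  by left; apply/setIdP; split; rewrite ?inE.
right; apply/imsetP; exists (h1 - u); last by rewrite subKr.
apply/setIdP; split=> /=; last by rewrite subKr addrC.
rewrite inE subKr ltn_neqAle le_u andbT.
by apply: contraNneq neq_u => /ord_inj/enum_rank_inj ->.
Qed.

Lemma mgf_half_le (t : R) (h : U * W) : 1 <= t ->
  \sum_(phi : {ffun U -> W}) t ^+ half_count phi h <=
  #|{ffun U -> W}|%:R * expR ((t - 1) * #|U|%:R / M).
Proof.
move=> t1; apply: (mgf_sum_le (tau := fun u => h.1 - u) h.2 t1) => u.
rewrite !inE subKr => lt_u.
by rewrite -leqNgt ltnW.
Qed.

(** First moment method: the hypothesis keeps the average over [phi] of the total cost of all [h]
    below 1, so some [phi] has total cost below 1 and fails for no [h]. *)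
Lemma exists_good_graph (B : {set U * W}) (a b : nat) :
  (#|U| * #|W|)%:R * (2 ^+ a * expR (- (#|B|%:R / M / 2)) +
    (expR (#|B|%:R / M) + expR (#|U|%:R / M)) / 2 ^+ b) < 1 ->
  exists phi : {ffun U -> W}, forall h,
    [/\ (a < cross_count B phi h)%N, (cross_count B phi h < b)%N
      & (self_count phi h < 2 * b)%N].
Proof.
move=> small.
(* Each failure, [cross_count <= a], [cross_count >= b] or [half_count >= b], contributes at least
   1. *)
pose cost (phi : {ffun U -> W}) (h : U * W) : R :=
  2 ^+ a * 2^-1 ^+ cross_count B phi h +
  (2 ^+ cross_count B phi h + 2 ^+ half_count phi h) / 2 ^+ b.
have cost_ge0 phi h : 0 <= cost phi h.
  by rewrite addr_ge0 // mulr_ge0 ?addr_ge0 ?invr_ge0 ?exprn_ge0 ?invr_ge0.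
have N0 : 0 < #|{ffun U -> W}|%:R :> R.
  by rewrite ltr0n; apply/card_gt0P; exists 0.
have [psi psi_small] : exists psi, \sum_h cost psi h < 1.
  apply: contrapT => /forallNP all_ge1.
  suff : #|{ffun U -> W}|%:R <= #|{ffun U -> W}|%:R *
     ((#|U| * #|W|)%:R * (2 ^+ a * expR (- (#|B|%:R / M / 2)) +
    (expR (#|B|%:R / M) + expR (#|U|%:R / M)) / 2 ^+ b)).
    by rewrite -{1}[_%:R]mulr1 ler_pM2l // leNgt small.
  apply: (@le_trans _ _ (\sum_phi \sum_h cost phi h)).
    rewrite -[leLHS]mulr1 card_mulr_sum; apply: ler_sum => phi _.
    by rewrite leNgt; apply/negP/all_ge1.
  rewrite exchange_big /= mulrCA -card_prod card_mulr_sum.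
  apply: ler_sum => h _; rewrite /cost big_split /= -mulr_sumr -mulr_suml big_split /=.
  rewrite mulrDr lerD //.
    rewrite mulrCA ler_pM2l ?exprn_gt0 //.
    have := @mgf_cross_le 2^-1 B h; rewrite invr_ge0 => /(_ (ler0n _ _)).
    by congr (_ <= _ * expR _); field; exact/lt0r_neq0/card_zmod_gt0.
  rewrite mulrA ler_pM2r ?invr_gt0 ?exprn_gt0 // mulrDr lerD //.
    have := @mgf_cross_le 2 B h (ler0n _ _).
    by congr (_ <= _ * expR _); ring.
  have := @mgf_half_le 2 h (ler1n _ _).
  by congr (_ <= _ * expR _); ring.
exists psi => h.
have cost_lt1 : cost psi h < 1.
  apply: le_lt_trans psi_small.
  by rewrite (bigD1 h) //= lerDl sumr_ge0.
have p0 n : 0 < 2 ^+ n :> R by rewrite exprn_gt0.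
have cross_lt : 2 ^+ a * 2^-1 ^+ cross_count B psi h < 1 :> R.
  apply: le_lt_trans cost_lt1; rewrite lerDl.
  by rewrite divr_ge0 ?addr_ge0 // ltW.
have rest_lt : (2 ^+ cross_count B psi h + 2 ^+ half_count psi h) < 2 ^+ b :> R.
  rewrite -[ltRHS]mul1r -ltr_pdivrMr //; apply: le_lt_trans cost_lt1; rewrite lerDr.
  by rewrite mulr_ge0 ?exprn_ge0 ?invr_ge0.
split.
- move: cross_lt; rewrite exprVn ltr_pdivrMr // mul1r.
  by rewrite ltr_eXn2l // ltr1n.
- rewrite -(@ltr_eXn2l R 2) ?ltr1n //.
  by apply: le_lt_trans rest_lt; rewrite lerDl ltW.
- apply: leq_ltn_trans (self_count_le psi h) _.
  rewrite ltn_pmul2l // -(@ltr_eXn2l R 2) ?ltr1n //.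
  by apply: le_lt_trans rest_lt; rewrite lerDr ltW.
Qed.
End RandomGraph.

(** * One level: polynomials of degree [d + e] split at ['X^e] *)

Section Level.
Set Implicit Arguments.
Unset Strict Implicit.
Variables (F : finFieldType) (d e : nat).
Local Notation U := {poly_d.+1 F}.
Local Notation W := {poly_e F}.

Definition glue (p : U * W) : {poly F} := (p.2 : {poly F}) + (p.1 : {poly F}) * 'X^e.

Lemma glueB (p r : U * W) : glue p - glue r = glue (p.1 - r.1, p.2 - r.2).
Proof. by rewrite /glue opprD addrACA -mulrBl. Qed.

Lemma drop_glue (p : U * W) : drop_poly e (glue p) = p.1.
Proof. by rewrite /glue drop_polyDMXn // size_npoly. Qed.

Lemma take_glue (p : U * W) : take_poly e (glue p) = p.2.
Proof. by rewrite /glue take_polyDMXn // size_npoly. Qed.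

Lemma glue_inj : injective glue.
Proof.
move=> [u w] [u' w'] eq_g; congr pair; apply: val_inj => /=.
  by rewrite -(drop_glue (u, w)) eq_g drop_glue.
by rewrite -(take_glue (u, w)) eq_g take_glue.
Qed.

Lemma glue_surj (f : {poly F}) : (size f <= (d + e).+1)%N -> exists p, f = glue p.
Proof.
move=> sf.
have s1 : (size (drop_poly e f) <= d.+1)%N.
  by rewrite size_drop_poly leq_subLR addnS addnC.
have s2 : (size (take_poly e f) <= e)%N by rewrite size_take_poly.
by exists (NPoly s1, NPoly s2); rewrite /glue /= poly_take_drop.
Qed.

Lemma size_glue_fst (p : U * W) : size p.1 = (size (glue p) - e)%N.
Proof. by rewrite -drop_glue size_drop_poly. Qed.

Lemma size_glue (p : U * W) : size p.1 = d.+1 -> size (glue p) = (d + e).+1.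
Proof. by rewrite size_glue_fst; lia. Qed.

(** [phi] lives on the whole group [U], but only [u] of full size enter, so that every member has
    degree exactly [d + e]. *)
Definition graph (phi : {ffun U -> W}) : seq {poly F} :=
  [seq glue (u, phi u) | u <- enum [set u : U | size u == d.+1]].

Lemma mem_graph (phi : {ffun U -> W}) (p : U * W) :
  glue p \in graph phi -> phi p.1 = p.2.
Proof. by case/mapP => u _ /glue_inj ->. Qed.

Lemma graph_uniq phi : uniq (graph phi).
Proof. by rewrite map_inj_uniq ?enum_uniq // => u v /glue_inj []. Qed.

Lemma size_mem_graph phi f : f \in graph phi -> size f = (d + e).+1.
Proof.
by case/mapP => u; rewrite mem_enum inE => /eqP su ->; exact: size_glue.
Qed.

Lemma size_graph_ge phi : (#|F| ^ d <= size (graph phi))%N.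
Proof.
rewrite size_map -cardE -card_npoly.
(* The monic top parts ['X^d + v] alone give [#|F| ^ d] members. *)
have size_monic (v : {poly_d F}) : size ('X^d + v : {poly F}) = d.+1.
  by rewrite size_polyDl size_polyXn // ltnS size_npoly.
have monic_le (v : {poly_d F}) : (size ('X^d + v : {poly F})%R <= d.+1)%N.
  by rewrite size_monic.
pose lift v : U := NPoly (monic_le v).
have lift_inj : injective lift.
  by move=> v w /(congr1 val) /= /addrI /val_inj.
rewrite -(card_imset _ lift_inj); apply/subset_leq_card/subsetP => _ /imsetP[v _ ->].
by rewrite inE /= size_monic.
Qed.

Lemma size_graph_le phi : (size (graph phi) <= #|F| ^ d.+1)%N.
Proof. by rewrite size_map -cardE -card_npoly max_card. Qed.

Definition glue_preim (B : seq {poly F}) := [set p : U * W | glue p \in B].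

Lemma card_glue_preim (B : seq {poly F}) : uniq B ->
  (forall f, f \in B -> size f <= d + e)%N -> #|glue_preim B| = size B.
Proof.
move=> uB sB; rewrite cardE -(size_map glue); apply/perm_size/uniq_perm => //.
  by rewrite map_inj_uniq ?enum_uniq //; exact: glue_inj.
move=> f; apply/mapP/idP => [[p]|fB]; first by rewrite mem_enum inE => + ->.
have [p def_f] := glue_surj (leqW (sB f fB)).
by exists p; rewrite // mem_enum inE -def_f.
Qed.

Lemma count_enum (A : {set U}) (P : pred U) :
  count P (enum A) = #|[set u in A | P u]|.
Proof.
rewrite -size_filter cardE; apply/perm_size/uniq_perm.
- exact/filter_uniq/enum_uniq.
- exact: enum_uniq.
- by move=> u; rewrite mem_filter !mem_enum inE andbC.
Qed.

(** Restricting the graph to [u] of full size loses nothing: if [glue p - f] has size at most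
    [d + e], its top part has size at most [d], so [u] has the size of [p.1]. *)
Lemma count_cross (B : seq {poly F}) phi (p : U * W) :
  (forall f, f \in B -> size f <= d + e)%N -> size (glue p) = (d + e).+1 ->
  count (fun f => glue p - f \in B) (graph phi) = cross_count (glue_preim B) phi p.
Proof.
move=> sB sp; rewrite count_map count_enum; apply: eq_card => u.
rewrite !inE /= glueB /= -[RHS]andTb; apply: andb_id2r => /sB.
set r := (_, _) => sr.
have s1 : (size p.1 = d.+1)%N by rewrite size_glue_fst sp; lia.
have sr1 : (size r.1 <= d)%N by rewrite size_glue_fst; lia.
have -> : (u : {poly F}) = (p.1 : {poly F}) - (r.1 : {poly F}).
  by rewrite -[in LHS](subKr p.1 u).
by rewrite size_polyDl ?s1 ?eqxx // size_polyN.
Qed.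

Lemma count_self phi (p : U * W) :
  (count (fun f => (glue p - f \in graph phi)%R && (f != glue p - f)%R) (graph phi)
   <= self_count phi p)%N.
Proof.
rewrite count_map count_enum; apply/subset_leq_card/subsetP => u.
rewrite !inE /= glueB /= => /and3P[_ /mem_graph /= phiE neq_u]; apply/andP; split.
  apply: contra neq_u => /eqP def_u.
  by apply/eqP; congr glue; congr pair => //; rewrite -phiE -def_u.
by rewrite phiE addrC subrK.
Qed.

Lemma exists_level (R : realType) (B : seq {poly F}) (a b : nat) :
  uniq B -> (forall f, f \in B -> size f <= d + e)%N ->
  exists S : seq {poly F},
  [/\ uniq S, (forall f, f \in S -> size f = (d + e).+1),
      (#|F| ^ d <= size S)%N, (size S <= #|F| ^ d.+1)%N &
      (#|F| ^ (d + e).+1)%:R * (2 ^+ a * expR (- ((size B)%:R / (#|F| ^ e)%:R / 2)) +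
       (expR ((size B)%:R / (#|F| ^ e)%:R) + expR ((#|F| ^ d.+1)%:R / (#|F| ^ e)%:R))
         / 2 ^+ b) < 1 :> R ->
      forall h : {poly F}, size h = (d + e).+1 ->
      [/\ (a < count (fun f => h - f \in B)%R S)%N,
          (count (fun f => h - f \in B)%R S < b)%N &
          (count (fun f => (h - f \in S) && (f != h - f))%R S < 2 * b)%N]].
Proof.
move=> uB sB.
set small := (_ < 1).
have [phi good] : exists phi : {ffun U -> W}, small -> forall p,
    [/\ (a < cross_count (glue_preim B) phi p)%N,
        (cross_count (glue_preim B) phi p < b)%N
      & (self_count phi p < 2 * b)%N].
  (* Uniqueness and sizes must hold at every level, so some [phi] is supplied even when [small]
     fails. *)
  have [is_small|] := boolP small; last by exists 0.
  have [|phi ?] := @exists_good_graph R U W (glue_preim B) a b; last by exists phi.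
  by rewrite !card_npoly -expnD addSn card_glue_preim.
exists (graph phi); split.
- exact: graph_uniq.
- exact: size_mem_graph.
- exact: size_graph_ge.
- exact: size_graph_le.
move=> is_small h sh; have [p def_h] := glue_surj (eq_leq sh).
rewrite def_h in sh *; have [lo hi self] := good is_small p.
by rewrite !count_cross //; split=> //; apply: leq_ltn_trans self; exact: count_self.
Qed.
End Level.

(** * Sizes of the top and low parts as functions of the degree *)

Section Scales.
Set Implicit Arguments.
Unset Strict Implicit.
Variables (q : nat).
(* [q ^ shift n] is of order [q ^ 7 * n.+1]; the factor [q ^ 7] makes the
   expected number of representations large compared with [n]. *)
Definition shift n := trunc_log q (q ^ 7 * n.+1).
Definition low n := (n - shift n)./2.
Definition high n := (n - low n)%N.

Lemma high_low n : (high n + low n = n)%N.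
Proof. by rewrite /high /low; lia. Qed.

Lemma high_le n : (high n <= low n + (shift n).+1)%N.
Proof. by rewrite /high /low; lia. Qed.

Hypothesis q_gt1 : (1 < q)%N.

Lemma shift_bounds n : (q ^ shift n <= q ^ 7 * n.+1 < q ^ (shift n).+1)%N.
Proof. by apply: trunc_log_bounds => //; rewrite muln_gt0 expn_gt0; lia. Qed.

(** As [n + 2 <= q * (n + 1)], the logarithm rises by at most one. *)
Lemma shiftS n : (shift n <= shift n.+1 <= (shift n).+1)%N.
Proof.
rewrite /shift leq_trunc_log ?leq_pmul2l ?expn_gt0 /=; [|lia..].
rewrite -trunc_logMp ?muln_gt0 ?expn_gt0 //=; last by lia.
apply: leq_trunc_log; rewrite mulnCA leq_pmul2l ?expn_gt0; nia.
Qed.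

Lemma highS n : (high n <= high n.+1 <= (high n).+1)%N.
Proof. by have := shiftS n; rewrite /high /low; lia. Qed.

(** In two steps [n - shift n] grows by at most 2, hence [low] by at most 1. This growth of [high]
    makes the level sizes dominate a geometric series. *)
Lemma high_SS n : ((high n).+1 <= high n.+2)%N.
Proof. by have := shiftS n; have := shiftS n.+1; rewrite /high /low; lia. Qed.

Lemma high_ge n : (10 <= n)%N -> (low n + shift n <= high n)%N.
Proof.
move=> n10; suff : (shift n <= n)%N by rewrite /high /low; lia.
rewrite -ltnS -(ltn_exp2l _ _ q_gt1).
have /andP[/leq_ltn_trans-> //] := shift_bounds n.
(* It remains to see [n + 1 < q ^ (n - 6)], which at [n = 10] follows from [11 < 2 ^ 4]. *)
have -> : n.+1 = (7 + (n - 6))%N by lia.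
rewrite expnD ltn_pmul2l ?expn_gt0; last by lia.
have -> : (n - 6 = (n - 10) + 4)%N by lia.
have -> : (7 + (n - 10 + 4) = (n - 10) + 11)%N by lia.
elim: (n - 10)%N => [|m IHm]; last by rewrite !addSn expnS; nia.
by apply: (@leq_trans (2 ^ 4)) => //; rewrite leq_exp2r.
Qed.
End Scales.

(** * Numerical estimate for the union bound over at most [q ^ N] polynomials *)

Lemma exists_failure_bound (R : realType) (q : nat) : (1 < q)%N ->
  exists c : nat, forall (N : nat) (x y : R), (0 < N)%N ->
    q%:R ^+ 5 * N%:R <= x -> x <= 4 * q%:R ^+ 9 * N%:R -> y <= 4 * q%:R ^+ 9 * N%:R ->
    (q ^ N)%:R * (2 ^+ N * expR (- (x / 2)) + (expR x + expR y) / 2 ^+ (c * N)) < 1 :> R.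
Proof.
move=> q1.
have q2 : 2 <= q%:R :> R by rewrite ler_nat.
have q0 : 0 < q%:R :> R by lra.
pose E : R := expR (4 * q%:R ^+ 9).
have E0 : 0 < E by exact: expR_gt0.
(* This [c] beats both upper tails: [q * E / 2 ^ c <= 1/4]. *)
have [c c_big] : exists c, 4 * q%:R * E <= 2 ^+ c.
  exists (Num.bound (4 * q%:R * E)).
  apply: ltW; apply: lt_trans (archi_boundP _) _; first by rewrite !mulr_ge0 // ltW.
  by rewrite -natrX ltr_nat ltn_expl.
exists c => N x y N0 x_ge x_le y_le.
(* Each of the three terms is at most an [N]-th power of a base not exceeding 1/4, so the total is
   at most 3/4. *)
have quarter (z : R) : 0 <= z -> 4 * z <= 1 -> z ^+ N <= 4^-1.
  move=> z0 z4; apply: (@le_trans _ _ (4^-1 ^+ N)).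
    by apply: lerXn2r; rewrite ?nnegrE ?invr_ge0 //; lra.
  by rewrite -[leRHS]expr1 ler_wiXn2l //; lra.
have lower_tail : (q ^ N)%:R * (2 ^+ N * expR (- (x / 2))) <= 4^-1.
  apply: (@le_trans _ _ ((q%:R * (2 * expR (- (q%:R ^+ 5 / 2)))) ^+ N)).
    rewrite natrX !exprMn -expRM_natr.
    rewrite !ler_wpM2l ?exprn_ge0 ?(ltW q0) // ler_expR.
    by rewrite mulNr lerN2 mulrAC ler_pM2r ?invr_gt0.
  apply: quarter; first by rewrite !mulr_ge0 ?expR_ge0 // ltW.
  have q4 : 2 ^+ 4 <= q%:R ^+ 4 :> R by apply: lerXn2r; rewrite ?nnegrE // ltW.
  have q5 : 8 * q%:R <= expR (q%:R ^+ 5 / 2) :> R.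
    apply: le_trans (expR_ge1Dx _).
    have : 2 ^+ 4 * q%:R <= q%:R ^+ 5 :> R by rewrite [leRHS]exprSr ler_pM2r.
    by lra.
  have -> : 4 * (q%:R * (2 * expR (- (q%:R ^+ 5 / 2)))) =
            8 * q%:R / expR (q%:R ^+ 5 / 2) :> R by rewrite expRN; ring.
  by rewrite ler_pdivrMr ?expR_gt0 // mul1r.
have tail (z : R) : z <= 4 * q%:R ^+ 9 * N%:R ->
    (q ^ N)%:R * (expR z / 2 ^+ (c * N)) <= 4^-1.
  move=> z_le; apply: (@le_trans _ _ ((q%:R * (E / 2 ^+ c)) ^+ N)).
    rewrite natrX !exprMn exprVn -exprM -expRM_natr.
    rewrite ler_wpM2l ?exprn_ge0 ?(ltW q0) // ler_wpM2r ?invr_ge0 ?exprn_ge0 //.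
    by rewrite ler_expR.
  apply: quarter; first by rewrite !mulr_ge0 ?invr_ge0 ?exprn_ge0 // ltW.
  by rewrite !mulrA ler_pdivrMr ?exprn_gt0 // mul1r.
rewrite mulrDl !mulrDr.
have := tail x x_le; have := tail y y_le; lra.
Qed.

(** * Recursive construction of all levels and their cumulative sizes *)

Section Tower.
Set Implicit Arguments.
Unset Strict Implicit.
Variables (F : finFieldType).
Local Notation q := #|F|.
Local Notation low := (low q).
Local Notation high := (high q).

Definition upto (S : nat -> seq {poly F}) n := flatten [seq S k | k <- iota 0 n].

Lemma uptoS S n : upto S n.+1 = upto S n ++ S n.
Proof. by rewrite /upto -addn1 iotaD map_cat flatten_cat /= cats0. Qed.

Definition level_sizes (S : nat -> seq {poly F}) :=
  forall n f, f \in S n -> size f = n.+1.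

Lemma mem_upto S n f : level_sizes S ->
  (f \in upto S n) = [&& (0 < size f)%N, (size f <= n)%N & f \in S (size f).-1].
Proof.
move=> sizeS; apply/flatten_mapP/and3P => [[k]|[f0 fn fS]].
  by rewrite mem_iota add0n /= => kn fk; rewrite (sizeS k).
by exists (size f).-1; rewrite // mem_iota; lia.
Qed.

Definition counts_between (a b n : nat) (B S : seq {poly F}) :=
  forall h : {poly F}, size h = n.+1 ->
      [/\ (a < count (fun f => h - f \in B)%R S)%N,
          (count (fun f => h - f \in B)%R S < b)%N &
          (count (fun f => (h - f \in S) && (f != h - f))%R S < 2 * b)%N].

Definition small_failure (R : realType) (a b n : nat) (B : seq {poly F}) : bool :=
  (q ^ n.+1)%:R * (2 ^+ a * expR (- ((size B)%:R / (q ^ low n)%:R / 2)) +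
    (expR ((size B)%:R / (q ^ low n)%:R) + expR ((q ^ (high n).+1)%:R / (q ^ low n)%:R))
      / 2 ^+ b) < 1 :> R.

Lemma exists_tower (R : realType) (a b : nat -> nat) :
  exists S : nat -> seq {poly F},
  [/\ level_sizes S, forall n, uniq (S n),
      forall n, (q ^ high n <= size (S n) <= q ^ (high n).+1)%N &
      forall n, small_failure R (a n) (b n) n (upto S n) ->
        counts_between (a n) (b n) n (upto S n) (S n)].
Proof.
pose spec n (B S : seq {poly F}) :=
  [/\ uniq S, (forall f, f \in S -> size f = n.+1),
      (q ^ high n <= size S <= q ^ (high n).+1)%N &
      small_failure R (a n) (b n) n B -> counts_between (a n) (b n) n B S].
(* The hypotheses on [x.2] stand under the existential, so that [choice] yields a total step
   function; [[::]] serves where they fail. *)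
have step_ex (x : nat * seq {poly F}) : exists S,
    uniq x.2 -> (forall f, f \in x.2 -> size f <= x.1)%N -> spec x.1 x.2 S.
  case: x => n B /=.
  have [uB|] := boolP (uniq B); last by exists [::].
  have [sB|nsB] := pselect (forall f, f \in B -> size f <= n)%N; last by exists [::].
  have [|S [uS sS loS hiS good]] :=
    @exists_level F (high n) (low n) R B (a n) (b n) uB.
    by move=> f /sB; rewrite high_low.
  exists S => _ _; split=> //; rewrite ?loS ?hiS //.
  - by move=> f /sS; rewrite high_low.
  - by move=> small h sh; apply: good; rewrite high_low.
have [step stepP] := choice step_ex.
pose B := fix B n := if n is m.+1 then B m ++ step (m, B m) else [::].
pose S n := step (n, B n).
have BE n : B n = upto S n by elim: n => // n IHn; rewrite uptoS -IHn.
have specS n : [/\ uniq (B n), (forall f, f \in B n -> size f <= n)%N & spec n (B n) (S n)].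
  have spec_n m : uniq (B m) -> (forall f, f \in B m -> size f <= m)%N -> spec m (B m) (S m).
    exact: (stepP (m, B m)).
  elim: n => [|n [uB sB [uS sS _ _]]]; first by split=> //; exact: spec_n.
  suff [uB' sB'] : uniq (B n.+1) /\ (forall f, f \in B n.+1 -> size f <= n.+1)%N.
    by split=> //; exact: spec_n.
  rewrite /= -/(S n); split.
    rewrite cat_uniq uB uS andbT /=; apply/hasPn => f /sS sf.
    by apply/negP => /sB; rewrite sf ltnn.
  by move=> f; rewrite mem_cat => /orP[/sB/leqW|/sS ->].
exists S; split=> [n f|n|n|n]; have [_ _ [uS sS szS good]] := specS n => //.
- exact: sS.
- by rewrite -BE.
Qed.

Hypothesis q_gt1 : (1 < q)%N.

(** The last level below [n] suffices, because [high] rises by at most one per step. *)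
Lemma size_upto_ge S n :
  (forall n, q ^ high n <= size (S n) <= q ^ (high n).+1)%N -> (0 < n)%N ->
  (q ^ high n <= q * size (upto S n))%N.
Proof.
move=> szS; case: n => // n _; have /andP[_ le_high] := highS q_gt1 n.
have /andP[lo _] := szS n.
apply: (@leq_trans (q ^ (high n).+1)); first by rewrite leq_exp2l.
by rewrite expnS leq_pmul2l ?uptoS ?size_cat; lia.
Qed.

Lemma size_upto_le S n :
  (forall n, q ^ high n <= size (S n) <= q ^ (high n).+1)%N ->
  (size (upto S n) <= 4 * q * q ^ high n)%N.
Proof.
move=> szS; suff /(_ n)[] : forall m, (size (upto S m) <= 4 * q * q ^ high m)%N /\
   (size (upto S m.+1) <= 4 * q * q ^ high m.+1)%N by [].
elim=> [|m [IH0 IH1]].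
  split; first by [].
  rewrite uptoS /=; have /andP[_ hi] := szS 0%N.
  apply: leq_trans hi _; rewrite expnS leq_mul ?leq_pmull // leq_pexp2l //; lia.
split=> //; rewrite !uptoS !size_cat.
have /andP[_ hi0] := szS m; have /andP[_ hi1] := szS m.+1.
have /andP[le1 _] := highS q_gt1 m; have /andP[le2 _] := highS q_gt1 m.+1.
have ss := leq_pexp2l (ltnW q_gt1) (high_SS q_gt1 m).
have l1 := leq_pexp2l (ltnW q_gt1) le1.
have l2 := leq_pexp2l (ltnW q_gt1) le2.
rewrite expnS in ss; rewrite !expnS in hi0 hi1.
have : (q * q ^ high m.+1 <= q * q ^ high m.+2)%N by rewrite leq_mul2l l2 orbT.
have : (2 * q ^ high m <= q * q ^ high m)%N by rewrite leq_mul2r q_gt1 orbT.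
set X := (q ^ high m)%N in IH0 ss l1 hi0 *.
set Y := (q ^ high m.+1)%N in l1 l2 hi1 *.
set Z := (q ^ high m.+2)%N in l2 ss *.
move=> XX YZ.
(* The total is at most [4qX + qX + qY], hence at most [7qZ / 2]. Since [Z] lies two steps above
   [X], the induction carries two consecutive bounds. *)
have : (2 * (q * X) <= q * Z)%N by rewrite mulnCA leq_mul2l; lia.
lia.
Qed.
End Tower.

(** * From counts on each level to [rep_count] *)

Section Counting.
Set Implicit Arguments.
Unset Strict Implicit.
Variables (F : finFieldType).
Local Notation q := #|F|.

(** With [N = n + 1], the ratio [q ^ high / q ^ low] lies between [q ^ 6 * N] and [q ^ 8 * N]; the
    bounds on [size B] cost a factor [q] below and [4 * q] above. *)
Lemma tower_small_failure (R : realType) (c n : nat) (B : seq {poly F}) :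
  (1 < q)%N ->
  (forall (N : nat) (x y : R), (0 < N)%N ->
    q%:R ^+ 5 * N%:R <= x -> x <= 4 * q%:R ^+ 9 * N%:R -> y <= 4 * q%:R ^+ 9 * N%:R ->
    (q ^ N)%:R * (2 ^+ N * expR (- (x / 2)) + (expR x + expR y) / 2 ^+ (c * N)) < 1 :> R) ->
  (10 <= n)%N -> (q ^ high q n <= q * size B)%N -> (size B <= 4 * q * q ^ high q n)%N ->
  small_failure R n.+1 (c * n.+1) n B.
Proof.
move=> q_gt1 bound n10 lo hi.
have q0 : (0 < q)%N by lia.
have p0 k : (0 < q ^ k)%N by rewrite expn_gt0 q0.
have r0 k : 0 < (q ^ k)%:R :> R by rewrite ltr0n.
have /andP[sh_le /ltnW sh_ge] := shift_bounds q_gt1 n.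
have hi_shift : (q ^ high q n <= q ^ low q n * (q * (q ^ 7 * n.+1)))%N.
  apply: (@leq_trans (q ^ low q n * q ^ (shift q n).+1)).
    by rewrite -expnD leq_pexp2l // high_le.
  by rewrite leq_pmul2l // expnS leq_pmul2l.
have lo_shift : (q ^ low q n * (q ^ 7 * n.+1) <= q * q ^ high q n)%N.
  apply: (@leq_trans (q ^ low q n * q ^ (shift q n).+1)); first by rewrite leq_pmul2l.
  by rewrite expnS mulnCA leq_pmul2l // -expnD leq_pexp2l // high_ge.
have cast9 : 4 * q%:R ^+ 9 * n.+1%:R = (4 * q ^ 9 * n.+1)%:R :> R.
  by rewrite -natrX -!natrM.
apply: bound => //.
- rewrite ler_pdivlMr // -natrX -!natrM ler_nat -(leq_pmul2l q0) -(leq_pmul2l q0).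
  apply: leq_trans (leq_mul (leqnn q) lo); apply: leq_trans lo_shift.
  by rewrite (expnD q 2 5); nia.
- rewrite ler_pdivrMr // cast9 -natrM ler_nat.
  apply: leq_trans hi _.
  have -> : (4 * q ^ 9 * n.+1 * q ^ low q n = 4 * q * (q ^ low q n * (q * (q ^ 7 * n.+1))))%N.
    by rewrite (expnD q 2 7); ring.
  by rewrite leq_pmul2l // muln_gt0.
- rewrite ler_pdivrMr // cast9 -natrM ler_nat.
  have -> : (4 * q ^ 9 * n.+1 * q ^ low q n = 4 * (q * (q ^ low q n * (q * (q ^ 7 * n.+1)))))%N.
    by rewrite (expnD q 2 7); ring.
  rewrite expnS; apply: (@leq_trans (q * (q ^ low q n * (q * (q ^ 7 * n.+1))))).
    by rewrite leq_pmul2l.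
  exact: leq_pmull.
Qed.

Variables (S : nat -> seq {poly F}) (omega : nat -> {poly F}).
Hypothesis sizeS : level_sizes S.
Hypothesis uniqS : forall n, uniq (S n).
Hypothesis range_omega : forall f,
  range omega f <-> (0 < size f)%N && (f \in S (size f).-1).

Lemma range_upto n (f : {poly F}) : (size f <= n)%N -> range omega f <-> f \in upto S n.
Proof. by move=> sf; rewrite range_omega mem_upto // sf. Qed.

Lemma level_range n (f : {poly F}) : f \in S n -> range omega f.
Proof. by move=> fS; rewrite range_omega (sizeS fS). Qed.

Lemma mem_rep_pairs h (fg : {poly F} * {poly F}) :
  fg \in fset_set (rep_pairs omega h) <-> rep_pairs omega h fg.
Proof.
rewrite in_fset_set; last exact: finite_rep_pairs.
by split; [exact: set_mem | exact: mem_set].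
Qed.

Lemma rep_count_ge n (h : {poly F}) : size h = n.+1 ->
  (count (fun f => h - f \in upto S n)%R (S n) <= rep_count omega h)%N.
Proof.
move=> sh; rewrite -size_filter -(size_map (fun f => (f, h - f))).
apply: uniq_leq_size.
  by rewrite map_inj_uniq ?filter_uniq // => f g [].
move=> _ /mapP[f + ->]; rewrite mem_filter => /andP[gB fS].
have sf := sizeS fS.
have sg : (size (h - f)%R <= n)%N by move: gB; rewrite mem_upto // => /and3P[].
apply/mem_rep_pairs; split=> /=.
- exact: level_range fS.
- exact/(range_upto sg).
- by rewrite addrC subrK.
- by rewrite sf sh leqnn leqW.
- by apply: contraTneq sg => <-; rewrite sf ltnn.
Qed.

Lemma rep_count_le n (h : {poly F}) : size h = n.+1 ->
  (rep_count omega h <= 2 * count (fun f => h - f \in upto S n)%R (S n) +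
     count (fun f => (h - f \in S n) && (f != h - f))%R (S n))%N.
Proof.
move=> sh.
pose L := [seq f <- S n | h - f \in upto S n].
pose L' := [seq f <- S n | (h - f \in S n) && (f != h - f)].
(* Three kinds of pairs: only the first, only the second, or both of top degree. *)
pose s := [seq (f, h - f) | f <- L] ++ [seq (h - f, f) | f <- L] ++ [seq (f, h - f) | f <- L'].
have -> : (2 * count (fun f => h - f \in upto S n)%R (S n) +
     count (fun f => (h - f \in S n) && (f != h - f))%R (S n))%N = size s.
  by rewrite !size_cat !size_map !size_filter; lia.
apply: uniq_leq_size; first exact: fset_uniq.
move=> [f g] /mem_rep_pairs[/= Rf Rg def_h [sf sg] neq].
have def_g : g = h - f by rewrite -def_h addrC addKr.
have def_f : f = h - g by rewrite -def_h addrK.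
have top (k : {poly F}) : (size k <= n.+1)%N -> range omega k -> (size k <= n)%N = false -> k \in S n.
  move=> sk /range_omega /andP[_ kS] nsk; have e : size k = n.+1 by lia.
  by rewrite e in kS.
rewrite sh in sf sg; rewrite !mem_cat.
have [sfn|nsf] := boolP (size f <= n)%N; have [sgn|nsg] := boolP (size g <= n)%N.
(* Two members of lower degree cannot sum to [h]. *)
- have := size_polyD f g; rewrite def_h sh; lia.
- apply/or3P/Or32/mapP; exists g; last by rewrite -def_f.
  rewrite mem_filter -def_f (top g sg Rg (negbTE nsg)) andbT.
  exact/range_upto.
- apply/or3P/Or31/mapP; exists f; last by rewrite -def_g.
  rewrite mem_filter -def_g (top f sf Rf (negbTE nsf)) andbT.
  exact/range_upto.
- apply/or3P/Or33/mapP; exists f; last by rewrite -def_g.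
  by rewrite mem_filter -def_g neq (top f) ?(top g) //; exact/negbTE.
Qed.
End Counting.

(** * Enumeration of the members and the final constants *)

Lemma exists_enumeration (T : countType) (P : pred T) (x0 : T) : P x0 ->
  exists omega : nat -> T, forall x, range omega x <-> P x.
Proof.
move=> Px0.
exists (fun k => if unpickle k is Some x then if P x then x else x0 else x0) => x; split.
  by case=> k _ <-; case: unpickle => // y; case: ifP.
by move=> Px; exists (pickle x); rewrite // pickleK Px.
Qed.

Theorem theorem1p1 (R : realType) (F : finFieldType) :
  exists omega : nat -> {poly F},
  exists (C1 C2 : R) (n0 : nat),
    [/\ 0 < C1, 0 < C2
      & forall h : {poly F}, (n0 < size h)%N ->
          C1 * (size h).-1%:R <= (rep_count omega h)%:R /\
          (rep_count omega h)%:R <= C2 * (size h).-1%:R].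
Proof.
have q_gt1 : (1 < #|F|)%N by exact: card_finNzRing_gt1.
have [c bound] := @exists_failure_bound R #|F| q_gt1.
have [S [sizeS uniqS szS good]] := @exists_tower F R succn (fun n => c * n.+1)%N.
have [f0 f0S] : exists f0, f0 \in S 0%N.
  have /andP[+ _] := szS 0%N; case: (S 0%N) => [|f0 s _]; last by exists f0; rewrite mem_head.
  by rewrite leqNgt expn_gt0 ltnW.
have [|omega range_omega] := @exists_enumeration {poly F}
    (fun f => (0 < size f)%N && (f \in S (size f).-1)) f0.
  by rewrite (sizeS _ _ f0S).
(* The level bounds give more than [n + 1] and at most [4 * c * (n + 1)] pairs, and
   [n + 1 <= 2 * n]. The successor keeps the constant positive; 10 comes from [high_ge]. *)
exists omega, 1, (8 * c).+1%:R, 10; split=> // h.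
case def_n : (size h) => [//|n] n10 /=.
have [|lo hi self] := good n _ h def_n.
  apply: (tower_small_failure q_gt1 bound) => //.
    by apply: size_upto_ge => //; lia.
  exact: size_upto_le.
have ge := rep_count_ge sizeS uniqS range_omega def_n.
have le := rep_count_le sizeS range_omega def_n.
split; first by rewrite mul1r ler_nat; lia.
by rewrite -natrM ler_nat; nia.
Qed.
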